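(* Let $\alpha\in[0,1]$. If $T \in \mathcal{B}_{A}(\mathcal{H})$, then $$\|UTU^{\sharp_A}\|_{A_\alpha}=\|T\|_{A_\alpha}\quad\text{for every $A$-unitary operator } U.$$
   Context: $\mathcal{H}$ is a complex Hilbert space with inner product $\langle\cdot,\cdot\rangle$, $\mathcal{B}(\mathcal{H})$ is the algebra of bounded linear operators on $\mathcal{H}$, and $A\in\mathcal{B}(\mathcal{H})$ is a fixed positive operator (self-adjoint with $\langle Ax,x\rangle\ge 0$ for all $x\in\mathcal{H}$). Put $\langle x,y\rangle_A=\langle Ax,y\rangle$ and $\|x\|_A=\sqrt{\langle x,x\rangle_A}=\|A^{1/2}x\|$. $R(\cdot)$ denotes range. Let $\mathcal{B}_A(\mathcal{H})=\{T\in\mathcal{B}(\mathcal{H}) : R(T^*A)\subseteq R(A)\}$, a subalgebra of $\mathcal{B}(\mathcal{H})$ whose elements $T$ are $A$-bounded (there is $c>0$ with $\|Tx\|_A\le c\|x\|_A$ for all $x\in\mathcal{H}$). For $T\in\mathcal{B}_A(\mathcal{H})$, $T^{\sharp_A}$ denotes the unique solution $X\in\mathcal{B}(\mathcal{H})$ of $AX=T^*A$ with $R(X)\subseteq\overline{R(A)}$; it again belongs to $\mathcal{B}_A(\mathcal{H})$. An operator $U\in\mathcal{B}_A(\mathcal{H})$ is called $A$-unitary if $\|Ux\|_A=\|U^{\sharp_A}x\|_A=\|x\|_A$ for all $x\in\mathcal{H}$. For an $A$-bounded operator $T$ and $\alpha\in[0,1]$, $\|T\|_{A_\alpha}=\sup\left\{\sqrt{\alpha|\langle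 Tx,x\rangle_A|^2+(1-\alpha)\|Tx\|_A^2} : x\in\mathcal{H},\ \|x\|_A=1\right\}$. *)

(* Defs.v *)
From HB Require Import structures.
From mathcomp Require Import all_boot all_order all_algebra.
From mathcomp Require Import sesquilinear complex.
From mathcomp Require Import all_classical all_reals all_analysis.

Set Implicit Arguments.
Unset Strict Implicit.
Unset Printing Implicit Defensive.

Import Order.TTheory GRing.Theory Num.Theory.
Import numFieldNormedType.Exports.

Local Open Scope classical_set_scope.
Local Open Scope ring_scope.
Local Open Scope complex_scope.

(* The inner product is linear in its first argument and conjugate-linear in
   the second one ({dot _ for _}); the norm of the normed module is the one it
   induces, so that completeness is completeness for that norm. *)
HB.mixin Record NormedModule_isHilbert (R : realType) H
    of CompleteNormedModule R[i] H := {
  inner : {dot H for (@Num.conj R[i])} ;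
  sqr_norm_inner : forall x : H, `|x| ^+ 2 = inner x x
}.

#[short(type="hilbertType")]
HB.structure Definition Hilbert (R : realType) :=
  { H of CompleteNormedModule R[i] H & NormedModule_isHilbert R H }.

Section Operators.
Context {R : realType} {H : hilbertType R}.
Implicit Types A T S U X : {linear H -> H}.

Definition bounded_op T := exists M : R, forall x, `|T x| <= M%:C * `|x|.

Definition is_adjoint T S :=
  bounded_op S /\ forall x y, inner (T x) y = inner x (S y).

(* In R[i], 0 <= z means that z is real and nonnegative. *)
Definition positive_op A :=
  [/\ bounded_op A, is_adjoint A A & forall x, 0 <= inner (A x) x].

Definition Ainner A (x y : H) : R[i] := inner (A x) y.

(* <x, x>_A is real when A is positive, so taking the real part loses nothing. *)
Definition Anorm A (x : H) : R := Num.sqrt (complex.Re (Ainner A x x)).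

(* T^* exists and is unique by the Riesz theorem; it appears here as the
   bounded operator Ts characterized by is_adjoint T Ts. *)
Definition BA A T :=
  bounded_op T /\
  exists2 Ts : {linear H -> H}, is_adjoint T Ts & range (Ts \o A) `<=` range A.

(* X = T^{sharp_A}; for T in BA A, such an X exists and is unique (Douglas). *)
Definition is_Asharp A T X :=
  [/\ bounded_op X,
      exists2 Ts : {linear H -> H}, is_adjoint T Ts & A \o X =1 Ts \o A
    & range X `<=` closure (range A)].

Definition Aunitary A U :=
  BA A U /\
  exists2 Us : {linear H -> H}, is_Asharp A U Us &
    forall x, Anorm A (U x) = Anorm A x /\ Anorm A (Us x) = Anorm A x.

Definition Aalpha_norm A (alpha : R) (T : H -> H) : R :=
  sup [set Num.sqrt (alpha * Normc.normc (Ainner A (T x) x) ^+ 2 +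
                     (1 - alpha) * Anorm A (T x) ^+ 2)
      | x in [set x | Anorm A x = 1]].

End Operators.

(* Main.v *)
(** Since [<U x, U x>_A = <x, x>_A], the operator [A (Us U - 1)] has zero
    quadratic form, hence vanishes ([H] is complex): [Us U x = x] modulo [ker A],
    and [ker A] is invariant under [T]. As [<U T Us x, x>_A = <T Us x, Us x>_A],
    the maps [x |-> Us x] and [y |-> U y] of the A-unit sphere match the values
    whose suprema are compared. *)
Require Import Defs.
From mathcomp Require Import all_boot all_order all_algebra.
From mathcomp Require Import sesquilinear complex.
From mathcomp Require Import all_classical all_reals all_analysis.

Import Order.TTheory GRing.Theory Num.Theory.
Local Open Scope classical_set_scope.
Local Open Scope ring_scope.

Section Asharp.
Context {R : realType} {H : hilbertType R}.
Implicit Types A T U S : {linear H -> H}.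

Lemma innerDl (x y z : H) : inner (x + y) z = inner x z + inner y z.
Proof. by rewrite linearDl. Qed.

Lemma innerDr (x y z : H) : inner x (y + z) = inner x y + inner x z.
Proof. by rewrite linearDr. Qed.

Lemma innerBl (x y z : H) : inner (x - y) z = inner x z - inner y z.
Proof. by rewrite linearBl. Qed.

Lemma innerBr (x y z : H) : inner x (y - z) = inner x y - inner x z.
Proof. by rewrite linearBr. Qed.

Lemma innerZl (a : R[i]) (x y : H) : inner (a *: x) y = a * inner x y.
Proof. by rewrite linearZl_LR. Qed.

Lemma innerZr (a : R[i]) (x y : H) : inner x (a *: y) = a^* * inner x y.
Proof. by rewrite linearZr_LR. Qed.

Lemma inner0r (x : H) : inner x 0 = 0.
Proof. by rewrite linear0r. Qed.

Lemma inner_eq0 (x : H) : inner x x = 0 -> x = 0.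
Proof.
by move=> x0; apply/eqP; rewrite -normr_eq0 -sqrf_eq0 sqr_norm_inner x0.
Qed.

Lemma inner_extl (x y : H) : (forall z, inner x z = inner y z) -> x = y.
Proof.
move=> xy; apply/eqP; rewrite -subr_eq0; apply/eqP; apply: inner_eq0.
by rewrite innerBl xy subrr.
Qed.

Lemma inner_extr (x y : H) : (forall z, inner z x = inner z y) -> x = y.
Proof.
move=> xy; apply/eqP; rewrite -subr_eq0; apply/eqP; apply: inner_eq0.
by rewrite innerBr xy subrr.
Qed.

(** Polarization: expanding the form at [v + u] makes [inner u (S v)] antisymmetric in [u] and [v],
    and over the complex scalars it is symmetric as well. *)
Lemma quadratic_form_eq0 S : (forall x, inner x (S x) = 0) -> forall x, S x = 0.
Proof.
move=> S0 x; apply: inner_extr => y; rewrite inner0r.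
have anti u v : inner u (S v) + inner v (S u) = 0.
  by have := S0 (v + u); rewrite linearD innerDr !innerDl !S0 add0r addr0.
(* The factor ['i] leaves the second slot as its conjugate [- 'i], so the vanishing sum becomes a
   vanishing difference. *)
have := anti ('i *: x) y.
rewrite linearZ innerZl innerZr conjCi mulNr -mulrBr.
move/eqP; rewrite mulf_eq0 (negPf (neq0Ci _)) /= subr_eq0 => /eqP E.
by have := anti x y; rewrite E => /eqP; rewrite -mulr2n mulrn_eq0 => /eqP.
Qed.

Lemma adjoint_uniq T S1 S2 : is_adjoint T S1 -> is_adjoint T S2 -> S1 =1 S2.
Proof. by move=> [_ h1] [_ h2] y; apply: inner_extr => x; rewrite -h1 h2. Qed.

(** Both sides are the adjoint of [U] at [A x]. This carries the isometry property from the witness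
    inside [Aunitary] over to any other choice of sharp. *)
Lemma Asharp_modA A U S1 S2 :
  is_Asharp A U S1 -> is_Asharp A U S2 -> forall x, A (S1 x) = A (S2 x).
Proof.
move=> [_ [V1 a1 e1] _] [_ [V2 a2 e2] _] x.
have /= -> := e1 x; have /= -> := e2 x.
exact: adjoint_uniq a1 a2 _.
Qed.

(** With [V] the adjoint of [U], both sides equal [inner x (V (A y))], since [V (A y) = A (S y)] and
    [A] is self-adjoint. *)
Lemma Asharp_adjoint A U S : positive_op A -> is_Asharp A U S ->
  forall x y, inner (A (U x)) y = inner (A x) (S y).
Proof.
move=> [_ [_ sA] _] [_ [V [_ aV] eV] _] x y.
by rewrite sA aV; have /= <- := eV y; rewrite -sA.
Qed.

(** The range inclusion writes [V (A z)] as [A w], so [inner (A (T x)) z = inner (A x) w] depends on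
    [x] only through [A x]. *)
Lemma BA_modA A T : positive_op A -> BA A T ->
  forall x y, A x = A y -> A (T x) = A (T y).
Proof.
move=> [_ [_ sA] _] [_ [V [_ aV] rV]] x y xy; apply: inner_extl => z.
have [w _ /= Vw] : range A (V (A z)) by apply: rV; exists z.
by rewrite !sA !aV -Vw -!sA xy.
Qed.

Lemma Ainner_modAl A (x y z : H) : A x = A y -> Ainner A x z = Ainner A y z.
Proof. by rewrite /Ainner => ->. Qed.

Lemma Ainner_modAr A : positive_op A ->
  forall x y z : H, A x = A y -> Ainner A z x = Ainner A z y.
Proof. by move=> [_ [_ sA] _] x y z xy; rewrite /Ainner !sA xy. Qed.

Lemma Anorm_modA A : positive_op A ->
  forall x y : H, A x = A y -> Anorm A x = Anorm A y.
Proof.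
move=> Ap x y xy; rewrite /Anorm (Ainner_modAl _ _ _ _ xy).
by rewrite (Ainner_modAr _ Ap _ _ _ xy).
Qed.

Lemma Anorm_eq_Ainner A : positive_op A ->
  forall x y : H, Anorm A x = Anorm A y -> Ainner A x x = Ainner A y y.
Proof.
move=> [_ _ pA] x y; rewrite /Anorm /Ainner; move: (pA x) (pA y).
case: (inner _ _) => a b; case: (inner _ _) => c d /=.
(* Positivity makes both imaginary parts zero and both real parts nonnegative, where the square root
   is injective. *)
rewrite !lecE /= => /andP[/eqP-> a0] /andP[/eqP-> c0] /eqP.
by rewrite eqr_sqrt// => /eqP->.
Qed.

Lemma Aisometry_sharpK A U S : positive_op A -> is_Asharp A U S ->
  (forall x, Anorm A (U x) = Anorm A x) -> forall x, A (S (U x)) = A x.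
Proof.
move=> Ap US isoU x; apply/eqP; rewrite -subr_eq0; apply/eqP.
have [_ [_ sA] _] := Ap.
(* At [x] this form is the difference of [Ainner A (U x) (U x)] and [Ainner A x x]. *)
apply: (quadratic_form_eq0 ((A \o (S \o U)) \- A)) => {}x /=.
rewrite innerBr -!sA -(Asharp_adjoint _ _ _ Ap US).
by rewrite [inner (A (U x)) _](Anorm_eq_Ainner _ Ap _ _ (isoU x)) subrr.
Qed.

End Asharp.

Theorem theorem2p3 (R : realType) (H : hilbertType R)
    (A : {linear H -> H}) (A_pos : positive_op A)
    (alpha : R) (alpha01 : 0 <= alpha <= 1)
    (T : {linear H -> H}) (T_BA : BA A T) :
  forall U Us : {linear H -> H}, Aunitary A U -> is_Asharp A U Us ->
    Aalpha_norm A alpha (U \o T \o Us) = Aalpha_norm A alpha T.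
Proof.
move=> U S [_ [S' US' iso]] US.
have isoU x : Anorm A (U x) = Anorm A x by have [] := iso x.
have isoS x : Anorm A (S x) = Anorm A x.
  rewrite (Anorm_modA _ A_pos _ _ (Asharp_modA _ _ _ _ US US' x)).
  by have [] := iso x.
have SUK := Aisometry_sharpK _ _ _ A_pos US isoU.
have value x : Ainner A (U (T (S x))) x = Ainner A (T (S x)) (S x).
  exact: Asharp_adjoint A_pos US _ _.
(* The two sets of values coincide, so the suprema agree whatever default [sup] takes on an empty or
   unbounded set. *)
rewrite /Aalpha_norm; congr sup; apply/seteqP; split => r /= [x x1 <-].
- by exists (S x); [rewrite isoS|rewrite /= value isoU].
- exists (U x); [by rewrite isoU|rewrite /= value isoU].
  (* [S (U x)] is [x] only modulo the kernel of [A], and [T] preserves this congruence. *)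
  have TSU := BA_modA _ _ A_pos T_BA _ _ (SUK x).
  by rewrite (Anorm_modA _ A_pos _ _ TSU) (Ainner_modAl _ _ _ _ TSU)
             (Ainner_modAr _ A_pos _ _ _ (SUK x)).
Qed.
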